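(* Fix a bipartite graph $G$ and edge capacities $u$. Any (peak-only) mechanism that always selects an allocation from $PO^*$ satisfies strong invariance if and only if it is group strategyproof.
   Context: **Setting.** $G=(S\cup D,E)$ is a finite bipartite graph with suppliers $S$, demanders $D$, edges $E\subseteq S\times D$, and capacities $u_{ij}\in[0,\infty]$. Each supplier $i$ (demander $j$) is an agent with a single-peaked preference relation $R_i$ ($R_j$) over its own net transfer in $\mathbb R_+$, with peak $s_i=s[R_i]\ge 0$ ($d_j=d[R_j]\ge 0$): strict preference strictly increases up to the peak and strictly decreases beyond it. $\mathcal R$ is the set of single-peaked preferences on $\mathbb R_+$ and $\mathcal R^{S\cup D}$ the set of profiles. A flow $\varphi=(\varphi_{ij})_{(i,j)\in E}$ with nonnegative entries induces net transfers $x_i=\sum_{j:(i,j)\in E}\varphi_{ij}$ and $y_j=\sum_{i:(i,j)\in E}\varphi_{ij}$; it is feasible if $\varphi_{ij}\le u_{ij}$, $x_i\le s_i$, $y_j\le d_j$ for all $i,j$. **Mechanisms and $PO^*$.** Net transfers $(x,y)$ are Pareto optimal if no other net transfers induced by a feasible flow make every agent weakly better off and at least one strictly better off. $PO^*$ is the set of Pareto optimal $(x,y)$ with $x\le s$ and $y\le d$. A mechanism assigns to each reported profile $R\in\mathcal R^{S\cup D}$ a flow and its net transfers $(x(R),y(R))$, and it is peak-only: the flow depends on $R$ only through the reported peaks $(s,d)$. It always selects from $PO^*$ if $(x(R),y(R))\in PO^*$ (with respect to the reported peaks) for every $R$. **Group strategyproofness.** It is a weakly dominant strategy for any coalition to report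 truthfully: for every $R\in\mathcal R^{S\cup D}$, every coalition $A\subseteq S\cup D$ and every joint misreport $R'_A\in\mathcal R^A$, if every agent in $A$ weakly prefers (according to its true preference in $R$) its net transfer at $(R'_A,R_{-A})$ to its net transfer at $R$, then every agent in $A$ is indifferent between the two. That is, no coalition can misreport so that all its members are weakly better off and at least one is strictly better off. **Strong invariance.** For all $R\in\mathcal R^{S\cup D}$, $i\in S$, $R'_i\in\mathcal R$: if either [$s[R_i]<x_i(R)$ and $s[R'_i]\le x_i(R)$] or [$s[R_i]>x_i(R)$ and $s[R'_i]\ge x_i(R)$], then $x_k(R'_i,R_{-i})=x_k(R)$ for all $k\in S$ and $y_l(R'_i,R_{-i})=y_l(R)$ for all $l\in D$; and the analogous property holds when a demander $j\in D$ changes its report (with $d[\cdot]$ and $y_j$ in the hypothesis and the same conclusion for all agents). *)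

(* Defs.v *)
From HB Require Import structures.
From mathcomp Require Import all_boot all_order all_algebra.
From mathcomp Require Import reals constructive_ereal.

Set Implicit Arguments.
Unset Strict Implicit.
Unset Printing Implicit Defensive.

Import Order.TTheory GRing.Theory Num.Theory.
Local Open Scope ring_scope.

(* A complete and transitive preference on [0, +oo[.  The relation is carried *)
(* by R, but only its restriction to nonnegative reals is constrained, and it *)
(* is only ever evaluated at net transfers, which are nonnegative.            *)
(* [weak_pref p x y] reads "x is at least as good as y".  The peak is a field *)
(* for convenience: the last two axioms determine it from the relation.       *)
Record preference (R : realType) := Preference {
  weak_pref : R -> R -> Prop;
  peak : R;
  peak_ge0 : 0 <= peak;
  weak_pref_total : forall x y : R, 0 <= x -> 0 <= y ->
    weak_pref x y \/ weak_pref y x;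
  weak_pref_trans : forall x y z : R, 0 <= x -> 0 <= y -> 0 <= z ->
    weak_pref x y -> weak_pref y z -> weak_pref x z;
  single_peaked_below : forall x y : R, 0 <= x -> x < y -> y <= peak ->
    weak_pref y x /\ ~ weak_pref x y;
  single_peaked_above : forall x y : R, peak <= x -> x < y ->
    weak_pref x y /\ ~ weak_pref y x
}.

Definition strict_pref (R : realType) (p : preference R) (x y : R) : Prop :=
  weak_pref p x y /\ ~ weak_pref p y x.

Definition indifferent (R : realType) (p : preference R) (x y : R) : Prop :=
  weak_pref p x y /\ weak_pref p y x.

Section Model.
Variables (R : realType) (S D : finType).

(* Agents are the elements of S + D: suppliers are inl, demanders are inr. *)
Definition profile := S + D -> preference R.

(* [update A P P'] is the profile (P'_A, P_{-A}). *)
Definition update (A : {set S + D}) (P P' : profile) : profile :=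
  fun a => if a \in A then P' a else P a.

Definition update1 (a : S + D) (P : profile) (p : preference R) : profile :=
  fun b => if b == a then p else P b.

Variable E : {set S * D}.

(* A flow is represented on all of S * D; values outside E are irrelevant. *)
Definition is_flow (phi : S -> D -> R) : Prop :=
  forall i j, (i, j) \in E -> 0 <= phi i j.

Definition net_transfer (phi : S -> D -> R) (a : S + D) : R :=
  match a with
  | inl i => \sum_(j | (i, j) \in E) phi i j
  | inr j => \sum_(i | (i, j) \in E) phi i j
  end.

Variable u : S -> D -> \bar R.

Definition feasible (P : profile) (phi : S -> D -> R) : Prop :=
  [/\ is_flow phi,
      forall i j, (i, j) \in E -> ((phi i j)%:E <= u i j)%E &
      forall a, net_transfer phi a <= peak (P a)].

Definition feasible_transfers (P : profile) (z : S + D -> R) : Prop :=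
  exists2 phi, feasible P phi & forall a, z a = net_transfer phi a.

Definition pareto_dominates (P : profile) (z' z : S + D -> R) : Prop :=
  (forall a, weak_pref (P a) (z' a) (z a)) /\
  (exists a, strict_pref (P a) (z' a) (z a)).

Definition pareto_optimal (P : profile) (z : S + D -> R) : Prop :=
  feasible_transfers P z /\
  ~ (exists2 z', feasible_transfers P z' & pareto_dominates P z' z).

Definition PO_star (P : profile) (z : S + D -> R) : Prop :=
  pareto_optimal P z /\ (forall a, z a <= peak (P a)).

Record mechanism := Mechanism {
  mech_flow : profile -> S -> D -> R;
  mech_is_flow : forall P, is_flow (mech_flow P)
}.

Definition outcome (M : mechanism) (P : profile) : S + D -> R :=
  net_transfer (mech_flow M P).

Definition peak_only (M : mechanism) : Prop :=
  forall P P' : profile, (forall a, peak (P a) = peak (P' a)) ->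
  forall i j, (i, j) \in E -> mech_flow M P i j = mech_flow M P' i j.

Definition selects_PO_star (M : mechanism) : Prop :=
  forall P : profile, PO_star P (outcome M P).

Definition group_strategyproof (M : mechanism) : Prop :=
  forall (P P' : profile) (A : {set S + D}),
  (forall a, a \in A ->
     weak_pref (P a) (outcome M (update A P P') a) (outcome M P a)) ->
  forall a, a \in A ->
    indifferent (P a) (outcome M (update A P P') a) (outcome M P a).

Definition strong_invariance (M : mechanism) : Prop :=
  forall (P : profile) (a : S + D) (p : preference R),
  (peak (P a) < outcome M P a /\ peak p <= outcome M P a) \/
  (outcome M P a < peak (P a) /\ outcome M P a <= peak p) ->
  forall b, outcome M (update1 a P p) b = outcome M P b.

End Model.

(* Main.v *)
Require Import Defs.
From mathcomp Require Import all_boot all_order all_algebra.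
From mathcomp Require Import reals constructive_ereal.

Import Order.TTheory GRing.Theory Num.Theory.
Local Open Scope ring_scope.

(** A Pareto optimal outcome in PO* gives nobody more than the reported peak,
    and the whole argument rests on this bound.  It implies that an agent
    weakly prefers a new outcome only if it receives at least as much as
    before, and exactly as much if it was already at its peak.

    Strong invariance implies group strategyproofness
    ([strong_invariance_update]).  Suppose that a coalition [A] moves the
    profile from [P] to [Q] and no member loses.  The members below their peak
    at [P] may adopt their reports of [Q] one after the other: their new peaks
    are at least what they get at [Q], hence at least what they get at [P], so
    the outcome never moves.  The members at their peak at [P] get that same
    amount at [Q], so starting from [Q] they may return to their true reports,
    again without moving the outcome.  Both paths end at the same peaks, hence
    the outcomes at [P] and [Q] coincide.

    Group strategyproofness implies strong invariance.  An agent below its peak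
    cannot raise its own transfer by any report, even to a level far above the
    peak: as the mechanism sees only peaks, it can be given a true preference
    for which overshooting is almost harmless ([unsatisfied_cannot_gain]).
    Applied to the change of report and to its reversal, this keeps the
    transfer of the deviator fixed.  The deviator can then help any other agent
    at no cost, so a coalition of two rules out that anybody gains
    ([neutral_report_helps_nobody]), in either direction. *)

(** * Single-peaked preferences *)

Section Preferences.
Local Set Implicit Arguments.
Local Unset Strict Implicit.
Variables (R : realType).
Implicit Types (p : preference R) (x y : R).

Lemma weak_pref_refl p x : 0 <= x -> weak_pref p x x.
Proof. by move=> x0; case: (weak_pref_total p x0 x0). Qed.

Lemma weak_pref_le p x y :
  0 <= y -> x <= peak p -> weak_pref p y x -> x <= y.
Proof.
move=> y0 xp pyx; rewrite leNgt; apply/negP => yx.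
by case: (single_peaked_below y0 yx xp).
Qed.

Lemma weak_pref_peak p y : 0 <= y -> weak_pref p y (peak p) -> y = peak p.
Proof.
move=> y0 pyk; apply/eqP; rewrite eq_le (weak_pref_le y0 _ pyk) // andbT.
rewrite leNgt; apply/negP => ky.
by case: (single_peaked_above (lexx _) ky).
Qed.

Definition tent (k e t : R) : R := if t <= k then t - k else e * (k - t).

Lemma tent_incr k e x y : x < y -> y <= k -> tent k e x < tent k e y.
Proof. by move=> xy yk; rewrite /tent yk (le_trans (ltW xy) yk) ltrD2r. Qed.

Lemma tent_decr k e x y : 0 < e -> k <= x -> x < y -> tent k e y < tent k e x.
Proof.
move=> e0 kx xy; rewrite /tent [y <= k]leNgt (le_lt_trans kx xy) /=.
case: ifPn => [xk|_]; last by rewrite ltr_pM2l // ltrD2l ltrN2.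
have -> : x = k by apply/eqP; rewrite eq_le xk kx.
by rewrite subrr pmulr_rlt0 // subr_lt0 (le_lt_trans kx xy).
Qed.

Lemma tent_preference k e : 0 <= k -> 0 < e ->
  exists p, peak p = k /\
    forall x y, weak_pref p x y <-> tent k e y <= tent k e x.
Proof.
move=> k0 e0; pose W x y : Prop := tent k e y <= tent k e x.
have Wtotal x y : 0 <= x -> 0 <= y -> W x y \/ W y x.
  by move=> _ _; apply/orP; rewrite orbC le_total.
have Wtrans x y z : 0 <= x -> 0 <= y -> 0 <= z -> W x y -> W y z -> W x z.
  by move=> _ _ _ Wxy Wyz; exact: le_trans Wyz Wxy.
have Wstrict x y : tent k e x < tent k e y -> W y x /\ ~ W x y.
  by move=> xy; rewrite /W ltW // leNgt xy.
have Wbelow x y : 0 <= x -> x < y -> y <= k -> W y x /\ ~ W x y.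
  by move=> _ xy yk; apply: Wstrict; exact: tent_incr.
have Wabove x y : k <= x -> x < y -> W x y /\ ~ W y x.
  by move=> kx xy; apply: Wstrict; exact: tent_decr.
by exists (Preference k0 Wtotal Wtrans Wbelow Wabove).
Qed.

(** The peak does not determine how the two sides of the peak compare: with a
    gentle enough slope on the right, every [y > x] beats a given [x] below
    the peak. *)
Lemma exists_preference_gt k x y : 0 <= k -> x < k -> x < y ->
  exists p, peak p = k /\ strict_pref p y x.
Proof.
move=> k0 xk xy.
have den_gt0 : 0 < k - x + `|y - k|.
  by rewrite ltr_pwDl ?subr_gt0.
(* The slope makes the loss [e * (y - k)] at [y] smaller than the loss
   [k - x] at [x]; the extra [k - x] in the denominator keeps it positive. *)
pose e := (k - x) / (k - x + `|y - k|).
have e0 : 0 < e by rewrite divr_gt0 // subr_gt0.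
have [p [pk pE]] := tent_preference k0 e0.
have ltxy : tent k e x < tent k e y.
  have [yk|ky] := leP y k; first exact: tent_incr.
  rewrite /tent (ltW xk) [y <= k]leNgt ky /=.
  rewrite -(opprB k x) -(opprB y k) mulrN ltrN2.
  rewrite /e mulrAC ltr_pdivrMr // ltr_pM2l ?subr_gt0 //.
  by rewrite ltr_pwDl ?subr_gt0 // ler_norm.
exists p; split=> //; split; first by apply/pE/ltW.
by move/pE; rewrite leNgt ltxy.
Qed.

End Preferences.

(** * Mechanisms bounded by the reported peaks *)

Section Mechanisms.
Local Set Implicit Arguments.
Local Unset Strict Implicit.
Variables (R : realType) (S D : finType) (E : {set S * D}).
Variable M : mechanism R E.
Implicit Types (P Q : profile R S D) (a b : S + D) (A B : {set S + D}).

Lemma outcome_ge0 P a : 0 <= outcome M P a.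
Proof.
by case: a => [i|j]; apply: sumr_ge0 => ? ?; exact: mech_is_flow.
Qed.

Hypothesis M_peak_only : peak_only M.

Lemma outcome_eq_peak P Q : (forall a, peak (P a) = peak (Q a)) ->
  forall b, outcome M P b = outcome M Q b.
Proof.
by move=> PQ [i|j]; apply: eq_bigr => ? ?; exact: M_peak_only.
Qed.

(** The invariance property passes from one agent to a set [B] because the
    outcome, hence the hypothesis on the agents of [B] that have not moved
    yet, is the same after each single move. *)
Lemma strong_invariance_update P Q B :
  strong_invariance M ->
  (forall a, a \in B -> peak (P a) = peak (Q a) \/
     outcome M P a < peak (P a) /\ outcome M P a <= peak (Q a)) ->
  forall b, outcome M (update B P Q) b = outcome M P b.
Proof.
move=> SI HB.
suff IH (s : seq (S + D)) : {subset s <= B} ->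
    forall b, outcome M (update [set x in s] P Q) b = outcome M P b.
  by have := IH (enum B); rewrite set_enum; apply=> a; rewrite mem_enum.
elim: s => [|a s IHs] sB b.
  by apply: outcome_eq_peak => c; rewrite /update inE.
have {}IHs : forall b, outcome M (update [set x in s] P Q) b = outcome M P b.
  by apply: IHs => c cs; apply: sB; rewrite inE cs orbT.
rewrite -IHs.
have [same|] := boolP ((a \in s) || (peak (P a) == peak (Q a))).
  apply: outcome_eq_peak => c; rewrite /update !inE.
  by have [->|//] := eqVneq c a; case/orP: same => [-> //|/eqP]; case: ifP.
rewrite negb_or => /andP[aNs /eqP Pa_neq].
have aB : a \in B by apply: sB; rewrite inE eqxx.
have [//|[lt_a le_a]] := HB a aB.
rewrite -(SI (update [set x in s] P Q) a (Q a)).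
  apply: outcome_eq_peak => c; rewrite /update1 /update !inE.
  by have [->|//] := eqVneq c a.
by right; rewrite IHs /update inE (negbTE aNs).
Qed.

Hypothesis M_le_peak : forall P a, outcome M P a <= peak (P a).

Lemma strong_invariance_gsp : strong_invariance M -> group_strategyproof M.
Proof.
move=> SI P P' A; set Q := update A P P' => prefQ.
have le_PQ a : a \in A -> outcome M P a <= outcome M Q a.
  move=> aA; apply: weak_pref_le (prefQ a aA); first exact: outcome_ge0.
  exact: M_le_peak.
have eq_peak a : a \in A -> peak (P a) <= outcome M P a ->
    outcome M Q a = peak (P a).
  move=> aA ge_a; have := prefQ a aA.
  have -> : outcome M P a = peak (P a).
    by apply/eqP; rewrite eq_le M_le_peak.
  exact/weak_pref_peak/outcome_ge0.
pose U := [set a in A | outcome M P a < peak (P a)].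
have fromP := @strong_invariance_update P Q U SI.
have fromQ := @strong_invariance_update Q P (A :\: U) SI.
have PQ a : outcome M Q a = outcome M P a.
  rewrite -fromP; last first.
    move=> c; rewrite inE => /andP[cA lt_c]; right; split=> //.
    exact: le_trans (le_PQ c cA) (M_le_peak _ _).
  rewrite -fromQ; last first.
    move=> c; rewrite !inE => /andP[+ cA].
    rewrite cA /= -leNgt => /(eq_peak c cA) Qc.
    have := M_le_peak Q c; rewrite le_eqVlt => /orP[/eqP Qpeak|lt_c].
      by left; rewrite -Qpeak Qc.
    by right; rewrite lt_c Qc.
  apply: outcome_eq_peak => c; rewrite /Q /update !inE.
  by case: (c \in A); case: (_ < _).
by move=> a aA; rewrite PQ; split; exact/weak_pref_refl/outcome_ge0.
Qed.

(** The misreport is given by the whole profile [Q] that it leads to; for a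
    peak-only mechanism it is enough that outsiders keep their peaks. *)
Lemma gsp_no_strict_gain P Q A a : group_strategyproof M ->
  (forall b, b \notin A -> peak (Q b) = peak (P b)) ->
  (forall b, b \in A -> weak_pref (P b) (outcome M Q b) (outcome M P b)) ->
  a \in A -> ~ strict_pref (P a) (outcome M Q a) (outcome M P a).
Proof.
move=> GSP QP prefQ aA [_]; apply.
have updE b : outcome M (update A P Q) b = outcome M Q b.
  apply: outcome_eq_peak => c; rewrite /update; case: ifPn => // cA.
  by rewrite QP.
rewrite -updE; apply: (GSP P Q A _ a aA).2 => b bA.
by rewrite updE; exact: prefQ.
Qed.

(** A transfer beyond the peak need not be a gain for the preference [P a],
    but replacing [P a] by another preference with the same peak leaves the
    outcome unchanged, and some such preference makes it a gain. *)
Lemma unsatisfied_cannot_gain P a p : group_strategyproof M ->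
  outcome M P a < peak (P a) ->
  outcome M (update1 a P p) a <= outcome M P a.
Proof.
move=> GSP lt_a; rewrite leNgt; apply/negP => gain.
have [q [qk q_gain]] := exists_preference_gt (peak_ge0 (P a)) lt_a gain.
pose P0 := update1 a P q.
have P0E b : outcome M P0 b = outcome M P b.
  apply: outcome_eq_peak => c; rewrite /P0 /update1.
  by have [->|] := eqVneq c a.
have P0a : P0 a = q by rewrite /P0 /update1 eqxx.
apply: (@gsp_no_strict_gain P0 (update1 a P p) [set a] a GSP).
- by move=> b; rewrite inE /P0 /update1 => /negbTE ->.
- by move=> b; rewrite inE => /eqP ->; rewrite P0E P0a; case: q_gain.
- by rewrite inE.
- by rewrite P0E P0a.
Qed.

Lemma neutral_report_helps_nobody P a p : group_strategyproof M ->
  outcome M (update1 a P p) a = outcome M P a ->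
  forall b, outcome M (update1 a P p) b <= outcome M P b.
Proof.
move=> GSP same b; rewrite leNgt; apply/negP => gain.
have ba : b != a by apply: contraTneq gain => ->; rewrite same ltxx.
have b_gain : strict_pref (P b) (outcome M (update1 a P p) b) (outcome M P b).
  apply: single_peaked_below => //; first exact: outcome_ge0.
  by have := M_le_peak (update1 a P p) b; rewrite {2}/update1 (negbTE ba).
apply: (@gsp_no_strict_gain P (update1 a P p) [set a; b] b GSP).
- by move=> c; rewrite !inE negb_or /update1 => /andP[/negbTE ->].
- move=> c; rewrite !inE => /orP[] /eqP ->; last by case: b_gain.
  by rewrite same; exact/weak_pref_refl/outcome_ge0.
- by rewrite !inE eqxx orbT.
- exact: b_gain.
Qed.

Lemma gsp_strong_invariance : group_strategyproof M -> strong_invariance M.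
Proof.
move=> GSP P a p [[lt_a _]|[lt_a le_p]].
  by move: lt_a; rewrite ltNge M_le_peak.
set Q := update1 a P p.
have Qa : Q a = p by rewrite /Q /update1 eqxx.
have backE b : outcome M (update1 a Q (P a)) b = outcome M P b.
  apply: outcome_eq_peak => c; rewrite /Q /update1.
  by have [->|] := eqVneq c a.
have same : outcome M Q a = outcome M P a.
  apply/eqP; rewrite eq_le unsatisfied_cannot_gain //= leNgt.
  apply/negP => lt_Q.
  have lt_peak : outcome M Q a < peak (Q a).
    by rewrite Qa; exact: lt_le_trans lt_Q le_p.
  have := unsatisfied_cannot_gain (P a) GSP lt_peak.
  by rewrite backE leNgt lt_Q.
move=> b; apply/eqP; rewrite eq_le neutral_report_helps_nobody //=.
by rewrite -backE neutral_report_helps_nobody // backE same.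
Qed.

End Mechanisms.

Theorem theorem2 (R : realType) (S D : finType) (E : {set S * D})
    (u : S -> D -> \bar R)
    (u_ge0 : forall (i : S) (j : D), (i, j) \in E -> (0 <= u i j)%E)
    (M : mechanism R E) (M_peak_only : peak_only M)
    (M_PO : selects_PO_star u M) :
  strong_invariance M <-> group_strategyproof M.
Proof.
have M_le_peak P a : outcome M P a <= peak (P a) by case: (M_PO P).
split; first exact: strong_invariance_gsp.
exact: gsp_strong_invariance.
Qed.
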